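(* (a) Let $(B,\diamond)$ be a finite-dimensional Zinbiel algebra and $(D=\oplus_{i\in\mathbb Z}D_i,\dashv,\vdash)$ a $\mathbb Z$-graded diassociative algebra. Define a binary operation on $D\otimes B$ by $$(d_1\otimes b_1)\cdot(d_2\otimes b_2)=(d_1\vdash d_2)\otimes(b_1\diamond b_2)+(d_1\dashv d_2)\otimes(b_2\diamond b_1)$$ for any $d_1,d_2\in D$ and $b_1,b_2\in B$. Then $(D\otimes B,\cdot)$ is a $\mathbb Z$-graded associative algebra, called an affine associative algebra from $(B,\diamond)$ by $(D=\oplus_{i\in\mathbb Z}D_i,\dashv,\vdash)$. (b) Moreover, let $(D=\oplus_{i\in\mathbb Z}D_i,\dashv,\vdash)$ be the $\mathbb Z$-graded diassociative algebra $D=\{f_1\partial_1+f_2\partial_2\mid f_1,f_2\in\Bbbk[t,t^{-1}]\}$ with $t^i\partial_m\dashv t^j\partial_n=t^{i+j+\delta_{1,n}}\partial_m$, $t^i\partial_m\vdash t^j\partial_n=t^{i+j+\delta_{1,m}}\partial_n$ for $i,j\in\mathbb Z$, $m,n\in\{1,2\}$, and with linear decomposition given by $D_i=\{f_1\partial_1+f_2\partial_2\mid f_k \text{ homogeneous with } \deg(f_k)=i-1,\ k=1,2\}$ for all $i\in\mathbb Z$. Let $B$ be a finite-dimensional vector space with a bilinear operation $\diamond$. Then $(D\otimes B,\cdot)$, with $\cdot$ defined by the same formula, is a $\mathbb Z$-graded associative algebra if and only if $(B,\diamond)$ is a Zinbiel algebra.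
   Context: $\Bbbk$ is a field of characteristic zero, $\delta$ is the Kronecker delta. A diassociative algebra $(D,\dashv,\vdash)$ is a vector space with two associative products satisfying $(d_1\dashv d_2)\dashv d_3=d_1\dashv(d_2\vdash d_3)$, $(d_1\vdash d_2)\dashv d_3=d_1\vdash(d_2\dashv d_3)$, $(d_1\dashv d_2)\vdash d_3=(d_1\vdash d_2)\vdash d_3$. A Zinbiel algebra $(B,\diamond)$ is a vector space with a bilinear operation satisfying $b_1\diamond(b_2\diamond b_3)=(b_1\diamond b_2)\diamond b_3+(b_2\diamond b_1)\diamond b_3$. A $\mathbb Z$-graded associative (resp. diassociative) algebra is an associative (resp. diassociative) algebra with a linear decomposition into finite-dimensional subspaces indexed by $\mathbb Z$ such that every product maps the components of degrees $i,j$ into the component of degree $i+j$. The grading on $D\otimes B$ is the one induced from $D$, with components $D_i\otimes B$.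
   Formalization: In (b) the decomposition is corrected to deg(f_1) = i-1, deg(f_2) = i, since with deg(f_1) = deg(f_2) = i-1 the algebra D is not graded: ∂_2 ⊣ ∂_2 = ∂_2 lies in D_1, not D_2. *)

(* Defs.v *)
From HB Require Import structures.
From mathcomp Require Import all_boot all_order all_algebra.
From mathcomp Require Import finmap.
From mathcomp.multinomials Require Import monalg.

Set Implicit Arguments.
Unset Strict Implicit.
Unset Printing Implicit Defensive.

Import GRing.Theory.
Local Open Scope ring_scope.

Section Algebras.
Variables (k : fieldType) (V : lmodType k).
Implicit Types (P : V -> Prop) (C : int -> V -> Prop).

Definition subspace P : Prop :=
  P 0 /\ forall (a : k) (u v : V), P u -> P v -> P (a *: u + v).

Definition finite_dimensional P : Prop :=
  exists (n : nat) (e : 'I_n -> V), (forall i, P (e i)) /\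
    forall v, P v -> exists c : 'I_n -> k, v = \sum_(i < n) c i *: e i.

(* V is the direct sum of the finite-dimensional subspaces C i *)
Definition linear_decomposition C : Prop :=
  [/\ forall i, subspace (C i),
      forall i, finite_dimensional (C i),
      forall v, exists (s : seq int) (f : int -> V),
        (forall i, C i (f i)) /\ v = \sum_(i <- s) f i
    & forall (s : seq int) (f : int -> V), uniq s -> (forall i, C i (f i)) ->
        \sum_(i <- s) f i = 0 -> forall i, i \in s -> f i = 0].

Definition graded_product C (mul : V -> V -> V) : Prop :=
  forall i j u v, C i u -> C j v -> C (i + j) (mul u v).

Definition graded_associative C (mul : {bilinear V -> V -> V}) : Prop :=
  [/\ linear_decomposition C, associative mul & graded_product C mul].

(* ld is the product written -|, rd is the product written |- *)
Definition diassociative (ld rd : V -> V -> V) : Prop :=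
  [/\ associative ld, associative rd,
      forall x y z, ld (ld x y) z = ld x (rd y z),
      forall x y z, ld (rd x y) z = rd x (ld y z)
    & forall x y z, rd (ld x y) z = rd (rd x y) z].

Definition graded_diassociative C (ld rd : {bilinear V -> V -> V}) : Prop :=
  [/\ linear_decomposition C, diassociative ld rd,
      graded_product C ld & graded_product C rd].

Definition zinbiel (dia : V -> V -> V) : Prop :=
  forall x y z, dia x (dia y z) = dia (dia x y) z + dia (dia y x) z.

End Algebras.

Section Tensor.
Variables (k : fieldType) (D B T : lmodType k) (t : {bilinear D -> B -> T}).

(* T, with t d b read as the pure tensor of d and b, is a tensor product of
   D and B over k *)
Definition tensor_product : Prop :=
  (forall (W : lmodType k) (f : {bilinear D -> B -> W}),
     exists g : {linear T -> W}, forall d b, g (t d b) = f d b) /\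
  (forall (W : lmodType k) (g h : {linear T -> W}),
     (forall d b, g (t d b) = h (t d b)) -> g =1 h).

Definition induced_grading (C : int -> D -> Prop) (i : int) (x : T) : Prop :=
  exists s : seq (D * B), (forall p, p \in s -> C i p.1) /\
    x = \sum_(p <- s) t p.1 p.2.

Definition affine_product (ld rd : D -> D -> D) (dia : B -> B -> B)
    (mul : T -> T -> T) : Prop :=
  forall d1 d2 b1 b2, mul (t d1 b1) (t d2 b2) =
    t (rd d1 d2) (dia b1 b2) + t (ld d1 d2) (dia b2 b1).

End Tensor.

(* A tensor product exists whenever B is finite-dimensional. *)
Section TensorExists.
Variables (k : fieldType) (D : lmodType k) (B : vectType k).

Definition coord_tensor (d : D) (b : B) : {ffun 'I_(\dim {:B}) -> D} :=
  [ffun i => coord (vbasis {:B}) i b *: d].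

Fact coord_tensor_bilinear : bilinear_for *:%R *:%R coord_tensor.
Proof.
split=> [b|d] a x y; apply/ffunP => i; rewrite !ffunE.
  by rewrite scalerDr !scalerA mulrC.
by rewrite linearP /= scalerDl scalerA.
Qed.
HB.instance Definition _ :=
  bilinear_isBilinear.Build k D B {ffun 'I_(\dim {:B}) -> D} *:%R *:%R
    coord_tensor coord_tensor_bilinear.

Lemma coord_tensorP : tensor_product (coord_tensor : {bilinear D -> B -> _}).
Proof.
pose e i := (vbasis {:B})`_i.
split=> [W f|W g h gh x].
  pose g (x : {ffun 'I_(\dim {:B}) -> D}) := \sum_i f (x i) (e i).
  have lin_g : linear g.
    move=> a x y; rewrite /g scaler_sumr -big_split; apply: eq_bigr => i _.
    by rewrite !ffunE /= linearPl.
  pose glin := GRing.isLinear.Build _ _ _ _ g lin_g.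
  exists (HB.pack g glin : {linear _ -> W}) => d b /=.
  rewrite /g [in RHS](coord_vbasis (memvf b)) raddf_sum.
  by apply: eq_bigr => i _; rewrite ffunE linearZl_LR /= linearZr_LR.
have -> : x = \sum_i coord_tensor (x i) (e i).
  apply/ffunP => j; rewrite sum_ffunE (bigD1 j) //= big1 ?addr0 => [|i nij];
    rewrite ffunE coord_free ?(basis_free (vbasisP _)) //.
    by rewrite eqxx scale1r.
  by rewrite (negPf nij) scale0r.
by rewrite !raddf_sum; apply: eq_bigr => i _; apply: gh.
Qed.

End TensorExists.

(* The space {f_1 d_1 + f_2 d_2 | f_1, f_2 in k[t, 1/t]}, as the vector space
   with basis the t^i d_m; ord0 : 'I_2 stands for m = 1 and ord_max for m = 2. *)
Section LaurentDerivations.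
Variable k : fieldType.

Definition laurent_der : lmodType k := {malg k[(int * 'I_2)%type]}.

Definition tpow (i : int) (m : 'I_2) : laurent_der := << (i, m) >>.

Definition bilinear_extension (op : int * 'I_2 -> int * 'I_2 -> int * 'I_2)
    (x y : laurent_der) : laurent_der :=
  \sum_(p <- msupp x) \sum_(q <- msupp y) << x@_p * y@_q *g op p q >>.

Definition delta1 (m : 'I_2) : int := (m == ord0)%:Z.

Definition ldL : laurent_der -> laurent_der -> laurent_der :=
  bilinear_extension (fun p q => (p.1 + q.1 + delta1 q.2, p.2)).

Definition rdL : laurent_der -> laurent_der -> laurent_der :=
  bilinear_extension (fun p q => (p.1 + q.1 + delta1 p.2, q.2)).

Lemma bilinear_extension_tpow op i m j n :
  bilinear_extension op (tpow i m) (tpow j n) = << op (i, m) (j, n) >>.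
Proof.
rewrite /bilinear_extension /tpow !msuppU oner_eq0 !big_seq_fset1 !mcoeffUU.
by rewrite mulr1.
Qed.

Lemma ldL_tpow i m j n : ldL (tpow i m) (tpow j n) = tpow (i + j + delta1 n) m.
Proof. exact: bilinear_extension_tpow. Qed.

Lemma rdL_tpow i m j n : rdL (tpow i m) (tpow j n) = tpow (i + j + delta1 m) n.
Proof. exact: bilinear_extension_tpow. Qed.

Lemma bilinear_extensionw op (A E : {fset (int * 'I_2)%type}) x y :
  (msupp x `<=` A)%fset -> (msupp y `<=` E)%fset ->
  bilinear_extension op x y =
    \sum_(p <- A) \sum_(q <- E) << x@_p * y@_q *g op p q >>.
Proof.
move=> leA leE; rewrite /bilinear_extension (big_fset_incl _ leA) /=.
  apply/eq_bigr=> p _; apply/big_fset_incl => // q _ /mcoeff_outdom ->.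
  by rewrite mulr0 monalgU0.
move=> p _ /mcoeff_outdom xp.
by rewrite big1 // => q _; rewrite xp mul0r monalgU0.
Qed.

Fact bilinear_extension_bilinear op :
  bilinear_for *:%R *:%R (bilinear_extension op).
Proof.
have malgUZ (a c : k) (p : int * 'I_2) : a *: << c *g p >> = << a * c *g p >>.
  by apply/malgP => q; rewrite mcoeffZ !mcoeffU mulrnAr.
have suppl a (x y : laurent_der) :
    (msupp (a *: x + y) `<=` msupp x `|` msupp y)%fset.
  apply: fsubset_trans (msuppD_le _ _) _.
  by apply: fsetSU; apply: msuppZ_le.
split=> [z|z] a x y.
  rewrite (bilinear_extensionw _ (suppl a x y) (fsubset_refl _)).
  rewrite (bilinear_extensionw _ (fsubsetUl _ (msupp y)) (fsubset_refl _)).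
  rewrite (bilinear_extensionw _ (fsubsetUr (msupp x) _) (fsubset_refl _)).
  rewrite /= scaler_sumr -big_split; apply: eq_bigr => p _ /=.
  rewrite scaler_sumr -big_split; apply: eq_bigr => q _ /=.
  by rewrite mcoeffD mcoeffZ malgUZ -monalgUD mulrDl mulrA.
rewrite (bilinear_extensionw _ (fsubset_refl _) (suppl a x y)).
rewrite (bilinear_extensionw _ (fsubset_refl _) (fsubsetUl _ (msupp y))).
rewrite (bilinear_extensionw _ (fsubset_refl _) (fsubsetUr (msupp x) _)).
rewrite /= scaler_sumr -big_split; apply: eq_bigr => p _ /=.
rewrite scaler_sumr -big_split; apply: eq_bigr => q _ /=.
by rewrite mcoeffD mcoeffZ malgUZ -monalgUD mulrDr mulrCA.
Qed.

HB.instance Definition _ op := bilinear_isBilinear.Build k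
  laurent_der laurent_der laurent_der *:%R *:%R
  (bilinear_extension op) (bilinear_extension_bilinear op).
HB.instance Definition _ := Bilinear.copy ldL ldL.
HB.instance Definition _ := Bilinear.copy rdL rdL.

(* the coefficient f_m of d_m in x is homogeneous of degree n (or zero) *)
Definition homogeneous_coef (m : 'I_2) (n : int) (x : laurent_der) : Prop :=
  forall i : int, x@_(i, m) != 0 -> i = n.

(* Degree i: deg f_1 = i - 1 and deg f_2 = i.  The products add an extra power
   of t for each absorbed d_1 and none for an absorbed d_2, so t^i d_1 has to
   have degree i + 1 and t^i d_2 degree i; see uniform_not_graded for the
   failure of the decomposition in which deg f_1 = deg f_2 = i - 1. *)
Definition laurent_grading (i : int) (x : laurent_der) : Prop :=
  homogeneous_coef ord0 (i - 1) x /\ homogeneous_coef ord_max i x.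

Lemma uniform_not_graded :
  ~ graded_product
      (fun i x => forall m, homogeneous_coef m (i - 1) x) ldL.
Proof.
move=> /(_ 1 1 (tpow 0 ord_max) (tpow 0 ord_max)) gr.
have h1 m : homogeneous_coef m (1 - 1) (tpow 0 ord_max).
  move=> i; rewrite /tpow mcoeffU xpair_eqE; have [<- //|_] := eqVneq 0 i.
  by rewrite /= eqxx.
have /(_ ord_max 0) := gr h1 h1.
rewrite ldL_tpow /tpow mcoeffU eqxx oner_eq0 => /(_ isT).
by [].
Qed.

End LaurentDerivations.

(* Main.v *)
(* A basis e_l of B gives coordinate maps phi_l : T -> D with
   x = \sum_l t (phi_l x) e_l, so gradings and products on T can be handled
   coordinatewise in D.  On pure tensors the two bracketings of a triple product
   only involve the three D-products x |- y |- z, x |- y -| z, x -| y -| z, and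
   their coefficients agree by the Zinbiel identity.  Conversely, in the Laurent
   algebra these three products can be told apart by which of the factors is not
   absorbed, so associativity yields the Zinbiel identity. *)
Require Import Defs.
From HB Require Import structures.
From mathcomp Require Import all_boot all_order all_algebra.
From mathcomp Require Import finmap ring.
From mathcomp.multinomials Require Import monalg.

Set Implicit Arguments.
Unset Strict Implicit.
Unset Printing Implicit Defensive.

Import GRing.Theory.
Local Open Scope ring_scope.

(** * Sums of homogeneous vectors and finite-dimensional subspaces *)

Section Decompositions.
Variables (k : fieldType) (V : lmodType k).

Lemma subspaceD (P : V -> Prop) u v : subspace P -> P u -> P v -> P (u + v).
Proof. by case=> _ P1 Pu Pv; rewrite -[u]scale1r; apply: P1. Qed.

Lemma subspaceZ (P : V -> Prop) a u : subspace P -> P u -> P (a *: u).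
Proof. by case=> P0 P1 Pu; rewrite -[_ *: _]addr0; apply: P1. Qed.

Lemma subspace_sum (P : V -> Prop) (I : eqType) (s : seq I) (F : I -> V) :
  subspace P -> (forall i, i \in s -> P (F i)) -> P (\sum_(i <- s) F i).
Proof.
move=> sP PF; rewrite big_seq; elim/big_ind: _ => //; first by case: sP.
by move=> u v; apply: subspaceD.
Qed.

(** Degrees may repeat in [L], whereas a decomposition has one vector per degree; adding up the
    entries of equal degree repairs this. *)
Lemma decomposition_by_degree (C : int -> V -> Prop) (L : seq (int * V)) :
  (forall i, subspace (C i)) -> (forall p, p \in L -> C p.1 p.2) ->
  exists (s : seq int) (f : int -> V),
    (forall i, C i (f i)) /\ \sum_(p <- L) p.2 = \sum_(i <- s) f i.
Proof.
move=> sC CL; exists (undup (map fst L)), (fun i => \sum_(p <- L | p.1 == i) p.2).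
split=> [i|].
  rewrite -big_filter; apply: subspace_sum => // p.
  by rewrite mem_filter => /andP[/eqP <-]; apply: CL.
(* After exchanging the sums, an entry [p] contributes only at [i = p.1], which [undup] lists
   exactly once. *)
under [RHS]eq_bigr do rewrite big_mkcond.
rewrite exchange_big big_seq [RHS]big_seq; apply: eq_bigr => p pL.
rewrite (bigD1_seq p.1) ?undup_uniq ?mem_undup ?map_f //= eqxx.
by rewrite big1 ?addr0 // => i /negPf; rewrite eq_sym => ->.
Qed.

Lemma finite_dimensional_fin (P : V -> Prop) (I : finType) (e : I -> V) :
  (forall i, P (e i)) ->
  (forall v, P v -> exists c : I -> k, v = \sum_i c i *: e i) ->
  finite_dimensional P.
Proof.
move=> Pe gen; exists #|I|, (fun i => e (enum_val i)); split=> // v /gen[c ->].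
exists (fun i => c (enum_val i)).
by rewrite (reindex (enum_val : 'I_#|I| -> I)) //;
  apply: onW_bij; apply: enum_val_bij.
Qed.

End Decompositions.

(** * Coordinates on the tensor product and the induced grading *)

Section TensorCoordinates.
Variables (k : fieldType) (D : lmodType k) (B : vectType k) (T : lmodType k).
Variable t : {bilinear D -> B -> T}.

Let n := \dim {:B}.
Let e (l : 'I_n) : B := (vbasis {:B})`_l.
Let cd (l : 'I_n) : B -> k := coord (vbasis {:B}) l.

(** The map [phi l] contracts with the [l]-th coordinate functional of [B] and comes from the
    existence half of the universal property. The expansion of [x] holds by the uniqueness half: its
    two sides are linear in [x] and agree on pure tensors. *)
Lemma tensor_coordinates : tensor_product t ->
  exists phi : 'I_n -> {linear T -> D},
    (forall l d b, phi l (t d b) = cd l b *: d) /\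
    (forall x, x = \sum_l t (phi l x) (e l)).
Proof.
case=> univ uniq_ext.
have phiP (l : 'I_n) :
    exists g : {linear T -> D}, forall d b, g (t d b) = cd l b *: d.
  pose f (d : D) (b : B) := cd l b *: d.
  have bil_f : bilinear_for *:%R *:%R f.
    split=> [b|d] a x y; rewrite /f /cd /=; first by rewrite scalerDr !scalerA mulrC.
    by rewrite linearP /= scalerDl scalerA.
  pose fm := bilinear_isBilinear.Build k D B D *:%R *:%R f bil_f.
  pose fb : {bilinear D -> B -> D} := HB.pack f fm.
  by have [g gP] := univ D fb; exists g.
have [phi phi_t] := fin_all_exists phiP; exists phi; split=> // x.
pose g (x : T) := \sum_l t (phi l x) (e l).
have lin_g : linear g.
  move=> a u v; rewrite /g scaler_sumr -big_split; apply: eq_bigr => l _ /=.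
  by rewrite linearP linearPl.
pose glin := GRing.isLinear.Build _ _ _ _ g lin_g.
pose gl : {linear T -> T} := HB.pack g glin.
apply: (uniq_ext T idfun gl) => d b /=.
rewrite /g [in LHS](coord_vbasis (memvf b)) linear_sumr; apply: eq_bigr => l _.
by rewrite phi_t linearZl_LR linearZr_LR.
Qed.

Lemma tensor_ind : tensor_product t -> forall P : T -> Prop,
  P 0 -> (forall x y, P x -> P y -> P (x + y)) -> (forall d b, P (t d b)) ->
  forall x, P x.
Proof.
move=> /tensor_coordinates[phi [_ phiE]] P P0 PD Pt x.
by rewrite (phiE x); elim/big_ind: _.
Qed.

(** Replaces the choice of a presentation of [x] by conditions in [D]. Contraction sends a pure
    tensor to a multiple of its [D]-factor, and conversely the coordinate expansion is itself a
    presentation. *)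
Lemma induced_grading_coordinates (phi : 'I_n -> {linear T -> D})
    (C : int -> D -> Prop) :
  (forall l d b, phi l (t d b) = cd l b *: d) ->
  (forall x, x = \sum_l t (phi l x) (e l)) ->
  (forall i, subspace (C i)) ->
  forall i x, induced_grading t C i x <-> forall l, C i (phi l x).
Proof.
move=> phi_t phiE sC i x; split=> [[s [Cs ->]] l|Cx].
  rewrite linear_sum; apply: subspace_sum => // p /Cs Cp.
  by rewrite /= phi_t; apply: subspaceZ.
exists [seq (phi l x, e l) | l <- enum 'I_n]; split=> [p /mapP[l _ ->]|].
  exact: Cx.
by rewrite big_map big_enum.
Qed.

Lemma induced_decomposition (C : int -> D -> Prop) : tensor_product t ->
  linear_decomposition C -> linear_decomposition (induced_grading t C).
Proof.
move=> /tensor_coordinates[phi [phi_t phiE]] [sC fdC decC dirC].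
have grE := induced_grading_coordinates phi_t phiE sC.
have sI i : subspace (induced_grading t C i).
  split=> [|a u v /grE Cu /grE Cv]; apply/grE => l.
    by rewrite linear0; case: (sC i).
  by rewrite linearP; case: (sC i) => _; apply.
split=> //.
- move=> i; have [m [e0 [Ce0 gen]]] := fdC i.
  (* The generators are the pure tensors of a generator of [C i] with a basis vector of [B]. *)
  apply: (@finite_dimensional_fin _ _ _ ('I_n * 'I_m)%type
            (fun p => t (e0 p.2) (e p.1))) => [p|x /grE Cx].
    by apply/grE => l; rewrite phi_t; apply: subspaceZ.
  have /fin_all_exists[c cE] l := gen _ (Cx l).
  exists (fun p => c p.1 p.2).
  rewrite -(pair_bigA _ (fun l j => c l j *: t (e0 j) (e l))) /= {1}(phiE x).
  apply: eq_bigr => l _; rewrite cE linear_sumlz.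
  by apply: eq_bigr => j _; rewrite linearZl_LR.
- move=> x.
  have /fin_all_exists[s /fin_all_exists[f sfP]] l := decC (phi l x).
  (* The homogeneous components of all the coordinates of [x]; one degree may come from several [l],
     hence the regrouping. *)
  pose L := flatten [seq [seq (i, t (f l i) (e l)) | i <- s l] | l <- enum 'I_n].
  have CL p : p \in L -> induced_grading t C p.1 p.2.
    case/flatten_mapP=> l _ /mapP[i _ ->]; apply/grE => l'; rewrite phi_t.
    by apply: subspaceZ => //; case: (sfP l).
  have [s' [g [Cg gE]]] := decomposition_by_degree sI CL.
  exists s', g; split=> //; rewrite -gE big_flatten /= big_map big_enum /=.
  rewrite {1}(phiE x); apply: eq_bigr => l _; case: (sfP l) => _ ->.
  by rewrite linear_sumlz big_map.
(* Directness is checked on each coordinate, where it is directness of [C] in [D]. *)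
- move=> s f us If f0 i si; rewrite (phiE (f i)) big1 // => l _.
  have -> : phi l (f i) = 0; last by rewrite linear0l.
  apply: (dirC s (fun i => phi l (f i))) => // [j|]; first by move/grE: (If j).
  by rewrite -linear_sum f0 linear0.
Qed.

End TensorCoordinates.

(** * The affine product: existence, uniqueness, associativity and grading *)

Section AffineProduct.
Variables (k : fieldType) (D : lmodType k) (B : vectType k) (T : lmodType k).
Variables (t : {bilinear D -> B -> T}) (ld rd : {bilinear D -> D -> D}).
Variable dia : {bilinear B -> B -> B}.
Hypothesis tP : tensor_product t.

Lemma affine_product_exists :
  exists mul : {bilinear T -> T -> T}, affine_product t ld rd dia mul.
Proof.
have [phi [phi_t _]] := tensor_coordinates tP.
pose e (l : 'I_(\dim {:B})) : B := (vbasis {:B})`_l.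
(* The required formula is imposed on the terms of the coordinate expansions of [x] and [y]; this is
   visibly bilinear, and expanding [b1] and [b2] in the basis recovers it on all pure tensors. *)
pose g (x y : T) := \sum_l \sum_m
  (t (rd (phi l x) (phi m y)) (dia (e l) (e m)) +
   t (ld (phi l x) (phi m y)) (dia (e m) (e l))).
have bil_g : bilinear_for *:%R *:%R g.
  split=> [z|z] a x y; rewrite /g /= scaler_sumr -big_split;
    apply: eq_bigr => l _;
    rewrite /= scaler_sumr -big_split; apply: eq_bigr => m _ /=.
    by rewrite linearP !linearPl scalerDr addrACA.
  by rewrite linearP !linearPr !linearPl scalerDr addrACA.
pose gm := bilinear_isBilinear.Build k T T T *:%R *:%R g bil_g.
pose gb : {bilinear T -> T -> T} := HB.pack g gm.
exists gb => d1 d2 b1 b2; rewrite /= /g.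
rewrite [in RHS](coord_vbasis (memvf b1)) [in RHS](coord_vbasis (memvf b2)).
rewrite linear_sumlz [X in _ + t _ X]linear_sumr !linear_sumr.
rewrite -big_split; apply: eq_bigr => l _ /=.
rewrite linear_sumr [X in _ + t _ X]linear_sumlz !linear_sumr.
rewrite -big_split; apply: eq_bigr => m _ /=.
by rewrite !phi_t !(linearZl_LR, linearZr_LR) /= !scalerA [in X in _ + X]mulrC.
Qed.

Lemma affine_product_unique (mul mul' : {bilinear T -> T -> T}) :
  affine_product t ld rd dia mul -> affine_product t ld rd dia mul' ->
  forall x y, mul' x y = mul x y.
Proof.
move=> mulE mulE' x y; elim/(tensor_ind tP): x => [|x x' IH IH'|d b].
- by rewrite !linear0l.
- by rewrite !linearDl IH IH'.
elim/(tensor_ind tP): y => [|y y' IH IH'|d' b'].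
- by rewrite !linear0r.
- by rewrite !linearDr IH IH'.
by rewrite mulE mulE'.
Qed.

Lemma affine_product_associative (mul : {bilinear T -> T -> T}) :
  affine_product t ld rd dia mul -> diassociative ld rd -> zinbiel dia ->
  associative mul.
Proof.
move=> mulE [ldA rdA ldld ldrd rdld] zin x y z.
elim/(tensor_ind tP): x => [|x x' IH IH'|d1 b1].
- by rewrite !linear0l.
- by rewrite !linearDl IH IH'.
elim/(tensor_ind tP): y => [|y y' IH IH'|d2 b2].
- by rewrite linear0l !linear0r linear0l.
- by rewrite linearDl !linearDr linearDl IH IH'.
elim/(tensor_ind tP): z => [|z z' IH IH'|d3 b3].
- by rewrite !linear0r.
- by rewrite !linearDr IH IH'.
(* Left multiplications commute, because the right side of the Zinbiel identity is symmetric in its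
   first two arguments. *)
have zinC b b' b'' : dia b (dia b' b'') = dia b' (dia b b'').
  by rewrite !zin addrC.
rewrite !mulE linearDl linearDr !mulE.
(* All triple products in [D] become one of [rd (rd d1 d2) d3], [ld (rd d1 d2) d3] and
   [ld (ld d1 d2) d3]. The coefficients of the mixed one match by [zinC], those of the other two by
   the Zinbiel identity. *)
rewrite rdA ldA -ldrd -ldld rdld.
rewrite (zinC b1 b3) (zin b1 b2) (zin b3 b2) !linearDr /=.
by rewrite -!addrA; congr (_ + _); rewrite [RHS]addrCA; congr (_ + _);
  rewrite addrC -addrA.
Qed.

(** Each coordinate of a product is a linear combination of [rd] and [ld] products of coordinates of
    the factors. *)
Lemma affine_product_graded (C : int -> D -> Prop)
    (mul : {bilinear T -> T -> T}) :
  affine_product t ld rd dia mul -> (forall i, subspace (C i)) ->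
  graded_product C ld -> graded_product C rd ->
  graded_product (induced_grading t C) mul.
Proof.
move=> mulE sC gld grd i j x y.
have [phi [phi_t phiE]] := tensor_coordinates tP.
have grE := induced_grading_coordinates phi_t phiE sC.
move=> /grE Cx /grE Cy; apply/grE => l.
rewrite (phiE x) (phiE y) linear_sumlz linear_sum.
apply: subspace_sum => // l1 _; rewrite linear_sumr linear_sum.
apply: subspace_sum => // l2 _; rewrite mulE linearD !phi_t.
by apply: subspaceD => //; apply: subspaceZ => //; [apply: grd|apply: gld].
Qed.

Lemma affine_graded_associative (C : int -> D -> Prop)
    (mul : {bilinear T -> T -> T}) :
  zinbiel dia -> graded_diassociative C ld rd ->
  affine_product t ld rd dia mul ->
  graded_associative (induced_grading t C) mul.
Proof.
move=> zin [decC dias gld grd] mulE; split.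
- exact: induced_decomposition.
- exact: affine_product_associative.
- by apply: affine_product_graded => //; case: decC.
Qed.

End AffineProduct.

(** * The Laurent diassociative algebra and the converse *)

Section Laurent.
Variable k : fieldType.
Implicit Types (x y z : laurent_der k) (p q : int * 'I_2).

Lemma malgZU (a c : k) p : a *: << c *g p >> = << a * c *g p >>.
Proof. by apply/malgP => q; rewrite mcoeffZ [X in _ * X]mcoeffU [RHS]mcoeffU mulrnAr. Qed.

Lemma laurent_coef_sum (I : Type) (s : seq I) (P : pred I)
    (F : I -> laurent_der k) p :
  (\sum_(i <- s | P i) F i)@_p = \sum_(i <- s | P i) (F i)@_p.
Proof. exact: (raddf_sum (mcoeff p)). Qed.

Lemma laurent_expand x : x = \sum_(p <- msupp x) x@_p *: tpow k p.1 p.2.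
Proof.
rewrite {1}[x]monalgE; apply: eq_bigr => -[i m] _.
by rewrite malgZU mulr1.
Qed.

Lemma laurent_ind (P : laurent_der k -> Prop) :
  P 0 -> (forall x y, P x -> P y -> P (x + y)) ->
  (forall a x, P x -> P (a *: x)) -> (forall i m, P (tpow k i m)) ->
  forall x, P x.
Proof.
move=> P0 PD PZ Pt x; rewrite (laurent_expand x).
by elim/big_ind: _ => // p _; apply: PZ.
Qed.

(** Four independent products are allowed because the diassociative axioms mix the two
    operations. *)
Lemma trilinear_ext
    (f1 f2 f3 f4 : {bilinear laurent_der k -> laurent_der k -> laurent_der k}) :
  (forall i1 m1 i2 m2 i3 m3,
     f1 (f2 (tpow k i1 m1) (tpow k i2 m2)) (tpow k i3 m3) =
     f3 (tpow k i1 m1) (f4 (tpow k i2 m2) (tpow k i3 m3))) ->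
  forall x y z, f1 (f2 x y) z = f3 x (f4 y z).
Proof.
move=> fE x y z; elim/laurent_ind: x => [|x x' IH IH'|a x IH|i1 m1].
- by rewrite !linear0l.
- by rewrite !linearDl IH IH'.
- by rewrite !linearZl_LR /= IH.
elim/laurent_ind: y => [|y y' IH IH'|a y IH|i2 m2].
- by rewrite linear0r !linear0l linear0r.
- by rewrite linearDr !linearDl linearDr IH IH'.
- by rewrite linearZr_LR !linearZl_LR linearZr_LR /= IH.
elim/laurent_ind: z => [|z z' IH IH'|a z IH|i3 m3].
- by rewrite !linear0r.
- by rewrite !linearDr IH IH'.
- by rewrite !linearZr_LR /= IH.
exact: fE.
Qed.

Lemma bilinear_extension_assoc
    (o1 o2 o3 o4 : int * 'I_2 -> int * 'I_2 -> int * 'I_2) :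
  (forall p q r, o1 (o2 p q) r = o3 p (o4 q r)) ->
  forall x y z,
    bilinear_extension o1 (bilinear_extension o2 x y) z =
    bilinear_extension o3 x (bilinear_extension o4 y z).
Proof.
move=> oE; have tE op p q :
    bilinear_extension op << p >> << q >> = << op p q >> :> laurent_der k.
  by case: p q => [i m] [j n]; apply: bilinear_extension_tpow.
apply: (trilinear_ext (f1 := bilinear_extension o1) (f2 := bilinear_extension o2)
  (f3 := bilinear_extension o3) (f4 := bilinear_extension o4)) => *.
by rewrite /tpow /= !tE oE.
Qed.

Lemma laurent_diassociative : diassociative (@ldL k) (@rdL k).
Proof.
split=> x y z.
- by symmetry; apply: bilinear_extension_assoc => p q r /=; congr pair; ring.
- by symmetry; apply: bilinear_extension_assoc => p q r /=; congr pair; ring.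
- by apply: bilinear_extension_assoc => p q r /=; congr pair; ring.
- by apply: bilinear_extension_assoc => p q r /=; congr pair; ring.
(* Both sides of this axiom are bracketed to the left, so each is compared with a common
   right-bracketed product. *)
- transitivity (rdL x (rdL y z)); last symmetry;
    by apply: bilinear_extension_assoc => p q r /=; congr pair; ring.
Qed.

Definition tpow_deg p : int := p.1 + delta1 p.2.

(** Merges the two coefficient conditions into a single degree function on the basis, which is
    additive under both products. *)
Lemma laurent_gradingP i x :
  laurent_grading i x <-> forall p, x@_p != 0 -> tpow_deg p = i.
Proof.
rewrite /tpow_deg /delta1; split=> [[h0 h1] [j m]|h].
  case: (eqVneq m ord0) => [->|m0] /=; first by move/h0->; rewrite subrK.
  have -> : m = ord_max by apply: val_inj; case: m m0 => [[|[|?]]].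
  by move/h1->; rewrite addr0.
split=> j /h /=; first by move=> <-; rewrite addrK.
by rewrite addr0.
Qed.

Lemma laurent_grading_subspace i : subspace (@laurent_grading k i).
Proof.
split=> [|a x y /laurent_gradingP hx /laurent_gradingP hy].
  by apply/laurent_gradingP => p; rewrite mcoeff0 eqxx.
apply/laurent_gradingP => p; rewrite mcoeffD mcoeffZ => nz.
case: (eqVneq x@_p 0) => [xp|/hx //]; apply: hy.
by move: nz; rewrite xp mulr0 add0r.
Qed.

Lemma laurent_gradingU (c : k) p :
  laurent_grading (tpow_deg p) (<< c *g p >> : laurent_der k).
Proof.
apply/laurent_gradingP => q; rewrite mcoeffU.
by case: (eqVneq p q) => [->|]; rewrite ?eqxx.
Qed.

Lemma bilinear_extension_graded op :
  (forall p q, tpow_deg (op p q) = tpow_deg p + tpow_deg q) ->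
  graded_product (@laurent_grading k) (bilinear_extension op).
Proof.
move=> opE i j x y /laurent_gradingP hx /laurent_gradingP hy.
have sub := laurent_grading_subspace (i + j).
rewrite /bilinear_extension; apply: subspace_sum => // p.
rewrite -mcoeff_neq0 => /hx pi; apply: subspace_sum => // q.
rewrite -mcoeff_neq0 => /hy qj; rewrite -pi -qj -opE.
exact: laurent_gradingU.
Qed.

Lemma laurent_decomposition : linear_decomposition (@laurent_grading k).
Proof.
have subL := laurent_grading_subspace.
split=> //.
- move=> i.
  (* For each [m], the only basis element with index [m] in degree [i]. *)
  pose g (m : 'I_2) : int * 'I_2 := (i - delta1 m, m).
  apply: (@finite_dimensional_fin _ _ _ 'I_2 (fun m => << 1 *g g m >>)) => [m|x].
    by rewrite -[i](subrK (delta1 m)); apply: (laurent_gradingU 1 (g m)).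
  move=> /laurent_gradingP hx; exists (fun m => x@_(g m)).
  apply/malgP => -[j m]; rewrite laurent_coef_sum (bigD1 m) //= malgZU mcoeffU mulr1.
  rewrite big1 ?addr0 => [|m' /negPf m'm]; last first.
    by rewrite malgZU mcoeffU /g xpair_eqE m'm andbF.
  rewrite /g xpair_eqE eqxx andbT.
  case: eqP => [<-|ne]; first by [].
  rewrite mulr0n; case: (eqVneq x@_(j, m) 0) => // /hx jm.
  by case: ne; rewrite -jm /tpow_deg addrK.
- move=> x.
  pose L := [seq (tpow_deg p, << x@_p *g p >> : laurent_der k) | p <- msupp x].
  have CL u : u \in L -> laurent_grading u.1 u.2.
    by case/mapP=> q _ ->; apply: laurent_gradingU.
  have [s [f [Cf fE]]] := decomposition_by_degree subL CL.
  by exists s, f; split=> //; rewrite -fE big_map -monalgE.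
- move=> s f us Cf f0 i si; apply/malgP => p; rewrite mcoeff0.
  (* A monomial [p] occurring in [f i] has degree [i], so it occurs in no other [f j]; its
     coefficient in the vanishing sum is therefore the one in [f i]. *)
  apply/eqP; apply/negPn/negP => nz.
  have pi := (laurent_gradingP _ _).1 (Cf i) p nz.
  have := congr1 (mcoeff p) f0; rewrite laurent_coef_sum mcoeff0 (bigD1_seq i) //=.
  rewrite big1 ?addr0 => [/eqP|j /eqP ji]; first by rewrite (negPf nz).
  apply/eqP; apply/negPn/negP => /((laurent_gradingP _ _).1 (Cf j) p) pj.
  by apply: ji; rewrite -pi.
Qed.

Lemma laurent_graded_diassociative :
  graded_diassociative (@laurent_grading k) (@ldL k) (@rdL k).
Proof.
split.
- exact: laurent_decomposition.
- exact: laurent_diassociative.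
- by apply: bilinear_extension_graded => p q; rewrite /tpow_deg /=; ring.
- by apply: bilinear_extension_graded => p q; rewrite /tpow_deg /=; ring.
Qed.

(* In (d_2 b1 . d_2 b2) . d_1 b3, the d_1-part collects exactly the terms where
   d_1 stands last and is never absorbed, that is the products |- |-. *)
Lemma zinbiel_of_affine_associative (B : vectType k)
    (dia : {bilinear B -> B -> B}) (T : lmodType k)
    (t : {bilinear laurent_der k -> B -> T}) (mul : {bilinear T -> T -> T}) :
  tensor_product t -> affine_product t (@ldL k) (@rdL k) dia mul ->
  associative mul -> zinbiel dia.
Proof.
case=> univ _ mulE mulA b1 b2 b3.
(* The linear map [g] induced by [f] reads off the [B]-component along [tpow k 0 ord0]. *)
pose f (d : laurent_der k) (b : B) : B := d@_(0, ord0) *: b.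
have bil_f : bilinear_for *:%R *:%R f.
  split=> [b|d] a x y; rewrite /f /= ?mcoeffD ?mcoeffZ.
    by rewrite scalerDl scalerA.
  by rewrite scalerDr !scalerA mulrC.
pose fm := bilinear_isBilinear.Build k (laurent_der k) B B *:%R *:%R f bil_f.
have [g gP] := univ B (HB.pack f fm).
have coefE i m : (tpow k i m)@_(0, ord0) = ((i == 0) && (m == ord0))%:R.
  by rewrite mcoeffU xpair_eqE.
(* [d2] is idempotent for both products. Absorbing [d1] on its right turns it into [d2'], which [g]
   does not see and which further left products with [d2] preserve. *)
have [d1 [d2 [d2' [rd22 ld22 [rd21 ld21] [rd22' ld22'] [c1 c2]]]]] :
    exists d1 d2 d2' : laurent_der k,
    [/\ rdL d2 d2 = d2, ldL d2 d2 = d2, rdL d2 d1 = d1 /\ ldL d2 d1 = d2',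
        rdL d2 d2' = d2' /\ ldL d2 d2' = d2'
      & d1@_(0, ord0) = 1 /\ d2'@_(0, ord0) = 0].
  exists (tpow k 0 ord0), (tpow k 0 ord_max), (tpow k 1 ord_max).
  split; last by rewrite !coefE.
  - exact: rdL_tpow.
  - exact: ldL_tpow.
  - by split; [apply: rdL_tpow | apply: ldL_tpow].
  - by split; [apply: rdL_tpow | apply: ldL_tpow].
have := congr1 g (mulA (t d2 b1) (t d2 b2) (t d1 b3)).
rewrite !mulE linearDl linearDr !mulE.
(* One term with [d1] remains in the right bracketing and two in the left one, from [rdL d2 d2] and
   [ldL d2 d2]: these are the three terms of the Zinbiel identity. *)
rewrite rd22 ld22 rd21 ld21 rd22' ld22' rd21 !linearD.
by rewrite !gP /= /f c1 c2 !scale0r !scale1r !addr0.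
Qed.

End Laurent.

Theorem proposition4p3 (k : fieldType) (char0 : [pchar k] =i pred0) :
  [/\
      forall (B : vectType k) (dia : {bilinear B -> B -> B})
        (D : lmodType k) (C : int -> D -> Prop) (ld rd : {bilinear D -> D -> D})
        (T : lmodType k) (t : {bilinear D -> B -> T}),
        zinbiel dia -> graded_diassociative C ld rd -> tensor_product t ->
        exists mul : {bilinear T -> T -> T},
          [/\ affine_product t ld rd dia mul,
              forall mul' : {bilinear T -> T -> T},
                affine_product t ld rd dia mul' ->
                forall x y, mul' x y = mul x y
            & graded_associative (induced_grading t C) mul],
      graded_diassociative (@laurent_grading k) (@ldL k) (@rdL k)
    & forall (B : vectType k) (dia : {bilinear B -> B -> B})
        (T : lmodType k) (t : {bilinear laurent_der k -> B -> T}),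
        tensor_product t ->
        exists mul : {bilinear T -> T -> T},
          [/\ affine_product t (@ldL k) (@rdL k) dia mul,
              forall mul' : {bilinear T -> T -> T},
                affine_product t (@ldL k) (@rdL k) dia mul' ->
                forall x y, mul' x y = mul x y
            & graded_associative (induced_grading t (@laurent_grading k)) mul
                <-> zinbiel dia]].
Proof.
have laurP := laurent_graded_diassociative k.
split=> // [B dia D C ld rd T t zin grD tP|B dia T t tP].
  have [mul mulE] := affine_product_exists ld rd dia tP; exists mul; split=> //.
    by move=> mul' mulE'; exact: (affine_product_unique tP mulE mulE').
  exact: (affine_graded_associative tP zin _ mulE).
have [mul mulE] := affine_product_exists (@ldL k) (@rdL k) dia tP.
exists mul; split=> //.
  by move=> mul' mulE'; exact: (affine_product_unique tP mulE mulE').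
split=> [[_ mulA _]|zin]; last exact: (affine_graded_associative tP zin _ mulE).
exact: (zinbiel_of_affine_associative tP mulE mulA).
Qed.
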